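(* Let $\Gamma$ be the commuting graph of a group $G$. Then each edge $\{a,b\}$ of $\Gamma$ that is not an isolated edge lies on a triangle of $\Gamma$.
   Context: For a group $G$ with centre $Z(G)$, the commuting graph $\Gamma(G)$ is the simple graph with vertex set $G\setminus Z(G)$ in which two distinct vertices $x,y$ are adjacent if and only if $xy=yx$. An edge $\{a,b\}$ is isolated if $\{a,b\}$ is the vertex set of a connected component. *)

(* Defs.v *)
(* MathComp [groupType] (groups of any cardinality). *)
From Stdlib Require Export Relation_Operators.
From mathcomp Require Export all_boot.

Set Implicit Arguments.
Unset Strict Implicit.
Unset Printing Implicit Defensive.

Local Open Scope group_scope.

(* The vertices form a Prop-valued subset of an ambient type T, so that
   possibly infinite, undecidable graphs are covered. *)
Record sgraph (T : Type) := SGraph {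
  vertex : T -> Prop;
  adj : T -> T -> Prop;
  adj_vertex : forall x y, adj x y -> vertex x /\ vertex y;
  adj_sym : forall x y, adj x y -> adj y x;
  adj_irrefl : forall x, ~ adj x x
}.

(* On vertices this is "joined by a path"; off the vertex set it is equality. *)
Definition connected T (Gamma : sgraph T) : T -> T -> Prop :=
  clos_refl_trans T (adj Gamma).

Definition component T (Gamma : sgraph T) (C : T -> Prop) : Prop :=
  exists2 x, vertex Gamma x & forall y, C y <-> connected Gamma x y.

(* [edge Gamma a b]: the unordered pair {a, b} is an edge. *)
Definition edge T (Gamma : sgraph T) (a b : T) : Prop := adj Gamma a b.

Definition isolated_edge T (Gamma : sgraph T) (a b : T) : Prop :=
  edge Gamma a b /\ component Gamma (fun y => y = a \/ y = b).

Definition triangle T (Gamma : sgraph T) (a b c : T) : Prop :=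
  [/\ edge Gamma a b, edge Gamma b c & edge Gamma c a].

Definition on_triangle T (Gamma : sgraph T) (a b : T) : Prop :=
  exists c, triangle Gamma a b c.

Section CommutingGraph.
Variable G : groupType.

(* The library's 'Z(G) exists only for finite groups. *)
Definition centre (x : G) : Prop := forall y : G, commute x y.

Definition commuting_adj (x y : G) : Prop :=
  [/\ ~ centre x, ~ centre y, x <> y & x * y = y * x].

Fact commuting_adj_vertex x y :
  commuting_adj x y -> ~ centre x /\ ~ centre y.
Proof. by case. Qed.

Fact commuting_adj_sym x y : commuting_adj x y -> commuting_adj y x.
Proof. by case=> zx zy neq xy; split=> // eq_yx; apply: neq. Qed.

Fact commuting_adj_irrefl x : ~ commuting_adj x x.
Proof. by case. Qed.

Definition commuting_graph : sgraph G :=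
  {| vertex := fun x => ~ centre x;
     adj := commuting_adj;
     adj_vertex := commuting_adj_vertex;
     adj_sym := commuting_adj_sym;
     adj_irrefl := commuting_adj_irrefl |}.

End CommutingGraph.

(* Main.v *)
Require Import Defs.
From Stdlib Require Import Classical.

Set Implicit Arguments.
Unset Strict Implicit.
Unset Printing Implicit Defensive.

Local Open Scope group_scope.

(** If the product [a * b] is not central, it is a vertex adjacent to both [a]
    and [b]. If it is central, then [a] and [b] have the same centralizer, so any
    further neighbour of one of them is a neighbour of both; without such a
    neighbour, [{a, b}] is a component. *)

Lemma centre1 (G : groupType) : centre (1 : G).
Proof. by move=> y; apply: commute_sym; apply: commute1. Qed.

(** Since [b] equals [a^-1 * (a * b)], it is a product of two elements that commute with [c]. *)
Lemma commute_centre_mulg (G : groupType) (a b c : G) :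
  centre (a * b) -> commute c a -> commute c b.
Proof.
move=> zab ca; rewrite -(mulKg a b).
apply: commuteM; first exact: commuteV.
exact: commute_sym (zab c).
Qed.

Lemma commuting_triangle (G : groupType) (a b c : G) :
  edge (commuting_graph G) a b -> ~ centre c -> commute c a -> commute c b ->
  c <> a -> c <> b -> on_triangle (commuting_graph G) a b.
Proof.
move=> eab zc ca cb neqa neqb; case: (eab) => za zb _ _.
exists c; split=> //; split=> //.
by move=> eq_bc; apply: neqb.
Qed.

Lemma noncentral_mulg_triangle (G : groupType) (a b : G) :
  edge (commuting_graph G) a b -> ~ centre (a * b) ->
  on_triangle (commuting_graph G) a b.
Proof.
move=> eab zab; case: (eab) => za zb _ ab.
apply: (commuting_triangle eab zab).
- by apply: commute_sym; apply: commuteM.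
- by apply: commute_sym; apply: commuteM => //; apply: commute_sym.
(* If [a * b] were equal to one of its factors, the other factor would be 1, hence central. *)
- rewrite -[RHS]mulg1 => /mulgI eb; apply: zb; rewrite eb; exact: centre1.
- rewrite -[RHS]mul1g => /mulIg ea; apply: za; rewrite ea; exact: centre1.
Qed.

Lemma component_edge T (Gamma : sgraph T) (a b : T) :
  edge Gamma a b ->
  (forall y, adj Gamma a y -> y = b) -> (forall y, adj Gamma b y -> y = a) ->
  component Gamma (fun y => y = a \/ y = b).
Proof.
move=> eab nbr_a nbr_b; exists a; first by case: (adj_vertex eab).
move=> y; split=> [[->|->]|]; [exact: rt_refl|exact: rt_step|].
(* The start is allowed to be [a] or [b], because transitivity cuts a path at an intermediate vertex
   that may be either. *)
suff closed x z : connected Gamma x z -> x = a \/ x = b -> z = a \/ z = b.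
  by move=> /closed; apply; left.
elim=> {x z} [x z xz|//|x u z _ IHxu _ IHuz /IHxu /IHuz //].
by case=> xE; move: xz; rewrite xE; [move/nbr_a; right | move/nbr_b; left].
Qed.

Theorem lemma3p5 (G : groupType) (a b : G) :
  edge (commuting_graph G) a b ->
  ~ isolated_edge (commuting_graph G) a b ->
  on_triangle (commuting_graph G) a b.
Proof.
move=> eab not_isolated.
have [zab|] := classic (centre (a * b)); last exact: noncentral_mulg_triangle.
apply: NNPP => no_triangle; apply: not_isolated; split=> //.
case: (eab) => _ _ _ ab.
(* This lets neighbours of [b] be treated like those of [a], with the roles swapped. *)
have zba : centre (b * a) by rewrite -ab.
(* A neighbour [y] of one endpoint, distinct from the other, would be the third vertex of a
   triangle; what remains is that [y] commutes with the other endpoint. *)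
apply: component_edge => // y [_ zy neq cy]; apply: NNPP => neq';
  apply: no_triangle; apply: (commuting_triangle eab zy) => //;
  try by [exact: commute_sym | move=> eq_y; apply: neq].
- exact: commute_centre_mulg zab (commute_sym cy).
- exact: commute_centre_mulg zba (commute_sym cy).
Qed.
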